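(* Let $G$ be a finitely generated residually finite group with infinitely many ends. Then $G$ is large.
   Context: A finitely generated group is large if it has a finite index subgroup possessing a homomorphism onto a non-abelian free group. *)

(* Defs.v *)
From HB Require Import structures.
From mathcomp Require Import all_boot all_fingroup finmap.
From mathcomp Require Import all_classical.

Set Implicit Arguments.
Unset Strict Implicit.
Unset Printing Implicit Defensive.

Local Open Scope group_scope.
Local Open Scope fset_scope.
Local Open Scope classical_set_scope.

(* Groups are MathComp's [groupType]s, which may be infinite. Subgroups are
   predicates satisfying [group_closed]; since the logic is classical, boolean
   predicates account for all subgroups. *)

Definition generates (G : groupType) (S : {fset G}) : Prop :=
  forall H : {pred G}, group_closed H -> {subset S <= H} ->
    forall x : G, x \in H.

Definition finitely_generated (G : groupType) : Prop :=
  exists S : {fset G}, generates S.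

Definition residually_finite (G : groupType) : Prop :=
  forall g : G, g != 1 ->
    exists (Q : finGroupType) (phi : {multiplicative G -> Q}), phi g != 1.

Definition left_coset (G : groupType) (H : {pred G}) (g : G) : set G :=
  [set g * h | h in [set h | h \in H]].

Definition finite_index (G : groupType) (H : {pred G}) : Prop :=
  finite_set (range (left_coset H)).

Definition is_free_basis (F : groupType) (X : set F) : Prop :=
  forall (K : groupType) (f : F -> K),
    (exists phi : {multiplicative F -> K}, forall x, X x -> phi x = f x) /\
    (forall phi psi : {multiplicative F -> K},
       (forall x, X x -> phi x = psi x) -> phi =1 psi).

Definition is_free_group (F : groupType) : Prop :=
  exists X : set F, is_free_basis X.

Definition nonabelian (F : groupType) : Prop :=
  exists x y : F, x * y <> y * x.

(* The homomorphism from H is given by a function on G of which only the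
   restriction to H matters. *)
Definition large (G : groupType) : Prop :=
  exists H : {pred G}, [/\ group_closed H, finite_index H &
    exists (F : groupType) (f : G -> F),
      [/\ is_free_group F, nonabelian F,
          {in H &, {morph f : x y / x * y}} &
          forall z : F, exists2 x, x \in H & f x = z]].

Section Ends.
Variables (V : choiceType) (e : rel V).

Definition joined_outside (K : {fset V}) (x y : V) : Prop :=
  exists p : seq V,
    [/\ path e x p, last x p = y & all [pred v | v \notin K] (x :: p)].

Definition component_outside (K : {fset V}) (C : set V) : Prop :=
  exists2 x, x \notin K & C = [set y | joined_outside K x y].

(* The space of ends of a (locally finite, undirected) graph is the inverse
   limit, over the finite sets K of vertices, of the sets of connected
   components of the complement of K. For a locally finite graph, the
   components picked by an element of the limit are automatically infinite. *)
Definition ends : set ({fset V} -> set V) :=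
  [set w | (forall K, component_outside K (w K)) /\
           (forall K L, (K `<=` L)%fset -> w L `<=` w K)].

End Ends.

Definition cayley_graph (G : groupType) (S : {fset G}) : rel G :=
  fun x y => (x^-1 * y \in S) || (y^-1 * x \in S).

(* The ends of a finitely generated group are those of its Cayley graph with
   respect to a finite generating set; up to bijection, they do not depend on
   the choice of the generating set. *)
Definition has_infinitely_many_ends (G : groupType) : Prop :=
  exists2 S : {fset G}, generates S & infinite_set (ends (cayley_graph S)).

(* Main.v *)
Require Import Defs.
From HB Require Import structures.
From mathcomp Require Import all_classical.
From mathcomp Require Import all_boot all_fingroup finmap.
From mathcomp Require Import zify.

Set Implicit Arguments.
Unset Strict Implicit.
Unset Printing Implicit Defensive.

Local Open Scope group_scope.

(** Residual finiteness makes Stallings' splitting theorem unnecessary.  Since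
    G has at least three ends, some finite connected set L of vertices of the
    Cayley graph cuts it into three pieces, each of which contains an infinite
    connected component.  Only finitely many elements move L so little that
    the translate meets L or its neighbours, so some normal subgroup N of
    finite index contains none of them except 1: the translates of L under N
    are pairwise disjoint and not adjacent, hence each of them lies in one piece of the
    complement of every other one.  This is a tree-like configuration on which
    N acts with trivial stabilisers of the translates ([separating_system]).

    Give each pair (n, i), the passage from nL into its i-th piece, a letter in
    some group F.  The product of the letters crossed by a path depends only on
    the ends of the path ([crossing_potential]): letters of finitely many
    translates have an explicit potential, and each pair of vertices is separated by
    finitely many translates.  If the letters are invariant under a subgroup M
    of N, the potential restricts to a homomorphism from M to F.

    For M normal of finite index, the passages modulo M are the edges of a
    finite connected graph: one kind of vertex consists of the translates
    modulo M, each on three edges, and the other kind of the regions between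
    translates modulo M.  Every such region touches two translates, because an
    infinite component of the complement of L contains a translate of L, and
    when M is deep enough these remain distinct modulo M
    ([region_two_translates]).  With a >= 2 translates modulo M there are thus
    3a edges and at most 5a/2 vertices, so that at least two edges lie outside
    a spanning tree ([two_spare_edges]).  Give these two edges the generators of the
    free group F of rank two and all other edges the trivial letter: the
    homomorphism from M to F is onto, since the tree can be crossed for free
    ([large_of_system]). *)

(** * Free groups *)

Section FreeGroup.
Variable I : choiceType.

Definition word := seq (I * bool).

Definition eval (K : groupType) (f : I -> K) (w : word) : K :=
  foldr (fun p acc => (if p.2 then f p.1 else (f p.1)^-1) * acc) 1 w.

Definition word_inv (w : word) : word := rev [seq (p.1, ~~ p.2) | p <- w].

Lemma eval_cat (K : groupType) (f : I -> K) v w :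
  eval f (v ++ w) = eval f v * eval f w.
Proof. by elim: v => [|p v IH] /=; rewrite ?mul1g // IH mulgA. Qed.

Lemma eval_inv (K : groupType) (f : I -> K) w :
  eval f (word_inv w) = (eval f w)^-1.
Proof.
elim: w => [|[x b] w IH] /=; first by rewrite invg1.
rewrite /word_inv map_cons rev_cons -cats1 eval_cat -/(word_inv w) IH /=.
by rewrite invgM mulg1; case: b => //=; rewrite invgK.
Qed.

(** Declaring two words equivalent when they agree in every group under every
    assignment makes both the group laws and the universal property of the
    quotient immediate, without reduced words. *)
Definition same_value : rel word := fun v w =>
  `[< forall (K : groupType) (f : I -> K), eval f v = eval f w >].

Lemma same_valueP v w :
  reflect (forall (K : groupType) (f : I -> K), eval f v = eval f w)
          (same_value v w).
Proof. exact: asboolP. Qed.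

Lemma same_value_refl : reflexive same_value.
Proof. by move=> w; apply/same_valueP. Qed.

Lemma same_value_sym : symmetric same_value.
Proof. by move=> v w; apply/same_valueP/same_valueP => e K f; rewrite e. Qed.

Lemma same_value_trans : transitive same_value.
Proof.
by move=> v u w /same_valueP e /same_valueP e'; apply/same_valueP=> K f; rewrite e.
Qed.

Canonical same_value_equiv :=
  EquivRel same_value same_value_refl same_value_sym same_value_trans.

Local Open Scope quotient_scope.

Definition free_group := {eq_quot same_value}.
HB.instance Definition _ := Choice.on free_group.
HB.instance Definition _ := Quotient.on free_group.

Implicit Types x y z : free_group.

Definition free_eval (K : groupType) (f : I -> K) x : K :=
  eval f (generic_quotient.repr x).

Lemma free_eval_pi (K : groupType) (f : I -> K) w :
  free_eval f (\pi_free_group w) = eval f w.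
Proof.
rewrite /free_eval; apply/same_valueP: K f.
by have /eqmodP := reprK (\pi_free_group w).
Qed.

Lemma free_ext x y :
  (forall (K : groupType) (f : I -> K), free_eval f x = free_eval f y) -> x = y.
Proof. by move=> e; rewrite -[x]reprK -[y]reprK; apply/eqmodP/same_valueP. Qed.

Definition free_one : free_group := \pi_free_group [::].
Definition free_mul x y : free_group :=
  \pi_free_group (generic_quotient.repr x ++ generic_quotient.repr y).
Definition free_inv x : free_group := \pi_free_group (word_inv (generic_quotient.repr x)).

Lemma free_eval1 (K : groupType) (f : I -> K) : free_eval f free_one = 1.
Proof. exact: free_eval_pi. Qed.

Lemma free_evalM (K : groupType) (f : I -> K) x y :
  free_eval f (free_mul x y) = free_eval f x * free_eval f y.
Proof. by rewrite free_eval_pi eval_cat. Qed.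

Lemma free_evalV (K : groupType) (f : I -> K) x :
  free_eval f (free_inv x) = (free_eval f x)^-1.
Proof. by rewrite free_eval_pi eval_inv. Qed.

Definition free_evalE := (free_eval1, free_evalM, free_evalV).

Lemma free_mulA : associative free_mul.
Proof. by move=> x y z; apply: free_ext => K f; rewrite !free_evalE mulgA. Qed.
Lemma free_mul1 : left_id free_one free_mul.
Proof. by move=> x; apply: free_ext => K f; rewrite !free_evalE mul1g. Qed.
Lemma free_1mul : right_id free_one free_mul.
Proof. by move=> x; apply: free_ext => K f; rewrite !free_evalE mulg1. Qed.
Lemma free_mulV : left_inverse free_one free_inv free_mul.
Proof. by move=> x; apply: free_ext => K f; rewrite !free_evalE mulVg. Qed.
Lemma free_Vmul : right_inverse free_one free_inv free_mul.
Proof. by move=> x; apply: free_ext => K f; rewrite !free_evalE mulgV. Qed.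

HB.instance Definition _ := isGroup.Build free_group
  free_mulA free_mul1 free_1mul free_mulV free_Vmul.

Definition letter (i : I) : free_group := \pi_free_group [:: (i, true)].

Lemma free_eval_letter (K : groupType) (f : I -> K) i :
  free_eval f (letter i) = f i.
Proof. by rewrite free_eval_pi /= mulg1. Qed.

Lemma eval_letter w : eval letter w = \pi_free_group w.
Proof.
elim: w => [|[i b] w IH] //=; apply: free_ext => K f.
rewrite {}IH free_evalM !free_eval_pi /=; congr (_ * _).
by case: b; rewrite ?free_evalV free_eval_letter.
Qed.

Lemma free_group_ind (P : free_group -> Prop) :
  P 1 -> (forall i, P (letter i)) -> (forall x, P x -> P x^-1) ->
  (forall x y, P x -> P y -> P (x * y)) -> forall x, P x.
Proof.
move=> P1 Pl PV PM x; rewrite -[x]reprK -eval_letter.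
elim: (generic_quotient.repr x) => [//|[i b] w IH] /=.
by apply: PM => //; case: b => //=; apply: PV.
Qed.

Section FreeEvalMorphism.
Variables (K : groupType) (f : I -> K).
HB.instance Definition _ :=
  isMultiplicative.Build free_group K (free_eval f) (free_evalM f).
End FreeEvalMorphism.

Lemma multiplicative1 (K L : groupType) (phi : {multiplicative K -> L}) :
  phi 1 = 1.
Proof. by apply: (mulgI (phi 1)); rewrite -gmulfM !mulg1. Qed.

Lemma multiplicativeV (K L : groupType) (phi : {multiplicative K -> L}) (x : K) :
  phi x^-1 = (phi x)^-1.
Proof. by apply: (mulgI (phi x)); rewrite -gmulfM !mulgV multiplicative1. Qed.

Lemma free_group_is_free : is_free_group free_group.
Proof.
exists (range letter)%classic => K f; split.
  exists (free_eval (fun i => f (letter i))) => _ [i _ <-].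
  exact: free_eval_letter.
move=> phi psi e; elim/free_group_ind => [|i|x IH|x y IHx IHy].
- by rewrite !multiplicative1.
- by apply: e; exists i.
- by rewrite !multiplicativeV IH.
- by rewrite !gmulfM IHx IHy.
Qed.

(** Two distinct letters can be sent to transpositions of three points that do
    not commute. *)
Lemma free_group_nonabelian (i j : I) : i != j -> nonabelian free_group.
Proof.
move=> ij; exists (letter i), (letter j) => /(congr1 (free_eval (fun k =>
  if k == i then tperm (inord 0 : 'I_3) (inord 1) else tperm (inord 1) (inord 2)))).
rewrite !free_evalM !free_eval_letter eqxx eq_sym (negPf ij) => /permP/(_ (inord 0)).
rewrite !permM tpermL tpermL.
rewrite (tpermD (z := inord 0)) -?val_eqE /= ?inordK // tpermL.
by move/(congr1 val); rewrite /= !inordK.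
Qed.

End FreeGroup.

(** * Spare edges of a finite graph *)

(** Grow a connected set of vertices from the root, adding one edge for each
    enlargement: an edge leaving the set adds at least one vertex.  Being
    spanned is expressed by propagation of predicates, which is the form in
    which spanning trees get applied to walks in an infinite graph. *)
Lemma spanning_edges (V E : finType) (s t : E -> V) (D : {set V}) (r : V) :
  r \in D -> (forall e, s e \in D) -> (forall e, t e \in D) ->
  (forall S : {set V}, r \in S -> (forall e, (s e \in S) = (t e \in S)) ->
     D \subset S) ->
  exists2 T : {set E}, (#|T| < #|D|)%N &
    forall P : V -> Prop, P r -> {in T, forall e, P (s e) <-> P (t e)} ->
      {in D, forall v, P v}.
Proof.
move=> rD sD tD conn.
pose spans (S : {set V}) (T : {set E}) :=
  forall P : V -> Prop, P r -> {in T, forall e, P (s e) <-> P (t e)} ->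
    {in S, forall v, P v}.
suff grow n : forall (S : {set V}) (T : {set E}), (#|D| - #|S| <= n)%N ->
    S \subset D -> r \in S -> (#|T| < #|S|)%N -> spans S T ->
    exists2 T : {set E}, (#|T| < #|D|)%N & spans D T.
  have [||||T ltT spanT] := grow _ [set r] finset.set0 (leqnn _).
  - by rewrite sub1set.
  - by rewrite set11.
  - by rewrite cards0 cards1.
  - by move=> P Pr _ v /set1P->.
  - by exists T.
elim: n => [|n IH] S T leDS SD rS ltTS spanT.
  have eSD : S = D by apply/eqP; rewrite eqEcard SD -subn_eq0 -leqn0.
  by exists T; rewrite -eSD.
have [DS|] := boolP (D \subset S).
  have eSD : S = D by apply/eqP; rewrite eqEsubset SD.
  by exists T; rewrite -eSD.
move=> nDS.
have [e ne] : exists e, (s e \in S) != (t e \in S).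
  apply: contrapT => none; case/negP: nDS; apply: conn => // e.
  by apply/eqP; apply: contrapT => /negP ne; apply: none; exists e.
have enlarge v : v \in D -> v \notin S ->
    (forall P : V -> Prop, {in S, forall u, P u} ->
       (P (s e) <-> P (t e)) -> P v) ->
    exists2 T : {set E}, (#|T| < #|D|)%N & spans D T.
  move=> vD vS Pv; apply: (IH (v |: S) (e |: T)).
  - have := subset_leq_card SD; have := cardsU1 v S; rewrite vS.
    have : (#|v |: S| <= #|D|)%N.
      by apply/subset_leq_card/subsetP=> u /setU1P [->//|/(subsetP SD)].
    by lia.
  - by apply/subsetP=> u /setU1P [->//|/(subsetP SD)].
  - by rewrite inE rS orbT.
  - by rewrite !cardsU1 vS; case: (e \notin T) => /=; lia.
  - move=> P Pr Pe; have PS : {in S, forall u, P u}.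
      by apply: spanT => // f fT; apply: Pe; rewrite inE fT orbT.
    move=> u /setU1P [->|]; last exact: PS.
    by apply: (Pv P PS); apply: Pe; rewrite setU11.
move: ne; case: (boolP (s e \in S)) => sS; case: (boolP (t e \in S)) => tS // _.
  by apply: (enlarge (t e)) => // P PS <-; apply: PS.
by apply: (enlarge (s e)) => // P PS ->; apply: PS.
Qed.

(** The graph is bipartite: its vertices are the points of A and the classes of
    R, and the edge (a, i) joins a to the class of (a, i).  Classes have at least
    two elements, so there are at most |A| + 3|A|/2 vertices, and a spanning
    tree misses at least |A|/2 + 1 >= 2 of the 3|A| edges. *)
Lemma two_spare_edges (A : finType) (R : rel (A * 'I_3)) (a0 : A) :
  equivalence_rel R -> (1 < #|A|)%N ->
  (forall e, exists2 e', e' != e & R e e') ->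
  (forall (U : {set A}) (W : {set A * 'I_3}), a0 \in U ->
     (forall e e', R e e' -> e \in W -> e' \in W) ->
     (forall e, (e.1 \in U) = (e \in W)) -> forall a, a \in U) ->
  exists e1 e2, e1 != e2 /\
    forall (P : A -> Prop) (Q : A * 'I_3 -> Prop), P a0 ->
      (forall e e', R e e' -> Q e -> Q e') ->
      (forall e, e != e1 -> e != e2 -> P e.1 <-> Q e) ->
      (forall a, P a) /\ (forall e, Q e).
Proof.
move=> eqR gtA1 other conn.
have Rxx e : R e e by have [] := eqR e e e.
have Rsym e e' : R e e' -> R e' e by move=> Ree'; have [_ /(_ Ree') <-] := eqR e e' e.
pose blocks := equivalence_partition R setT.
have partE : partition blocks setT.
  by apply: equivalence_partitionP => x y z _ _ _; apply: eqR.
pose block e : {set A * 'I_3} := [set e' in setT | R e e'].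
have blockP e : block e \in blocks by apply: imset_f; rewrite inE.
have card_blocks : (#|blocks| * 2 <= #|A| * 3)%N.
  have <- : #|[set: A * 'I_3]| = (#|A| * 3)%N by rewrite cardsT card_prod card_ord.
  rewrite (card_partition partE) -sum_nat_const; apply: leq_sum => _ /imsetP [e _ ->].
  have [e' ne Ree'] := other e.
  have two : #|[set e'; e]| = 2 by rewrite cards2 ne.
  rewrite -[X in (X <= _)%N]two.
  by apply/subset_leq_card/subsetP=> f /set2P [] ->; rewrite !inE //= ?Ree' ?Rxx.
pose s (e : A * 'I_3) : A + {set A * 'I_3} := inl e.1.
pose t (e : A * 'I_3) : A + {set A * 'I_3} := inr (block e).
pose D : {set A + {set A * 'I_3}} :=
  [set inl a | a in setT] :|: [set inr b | b in blocks].
have inlD a : inl a \in D by rewrite inE imset_f // inE.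
have inrD b : b \in blocks -> inr b \in D by move=> bb; rewrite inE orbC imset_f.
have card_D : (#|D| <= #|A| + #|blocks|)%N.
  apply: leq_trans (leq_card_setU _ _) _.
  by rewrite leq_add ?leq_imset_card // -cardsT leq_imset_card.
have [| | | |T ltT spanT] := @spanning_edges _ _ s t D (inl a0).
- exact: inlD.
- by move=> e; apply: inlD.
- by move=> e; apply: inrD.
- move=> S a0S st.
  have inS a : inl a \in S.
    have := conn [set a | inl a \in S] [set e | inr (block e) \in S].
    rewrite inE => /(_ a0S) H; have := H _ _ a; rewrite inE; apply => [e e' Ree'|e].
      rewrite !inE => eS; suff <- : block e = block e' by [].
      by apply/setP=> f; rewrite !inE; have [_ /(_ Ree') ->] := eqR e e' f.
    by rewrite !inE; apply: st.
  apply/subsetP=> _ /setUP [/imsetP [a _ ->] //|/imsetP [_ /imsetP [e _ ->] ->]].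
  by rewrite -/(block e) -st inS.
have : (1 < #|~: T|)%N.
  have cE : (#|T| + #|~: T| = #|A| * 3)%N by rewrite cardsC card_prod card_ord.
  have : (#|T| < #|A| + #|blocks|)%N by apply: leq_trans ltT card_D.
  move: card_blocks cE gtA1; move: #|blocks| #|T| #|~: T| #|A|.
  by move=> b u v a; lia.
case/card_gt1P => e1 [e2 []]; rewrite !inE => e1T e2T ne; exists e1, e2; split=> //.
move=> P Q Pa0 RQ PQ.
pose PV v := match v with inl a => P a | inr b => exists2 e, block e = b & Q e end.
have PVt e : PV (t e) <-> Q e.
  split=> [[f] /setP ef Qf|Qe]; last by exists e.
  by apply: RQ Qf; have := ef e; rewrite !inE Rxx.
have PD : {in D, forall v, PV v}.
  apply: spanT => // e eT; rewrite PVt; apply: PQ.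
    by apply: contraNneq e1T => <-.
  by apply: contraNneq e2T => <-.
by split=> [a|e]; [exact: (PD (inl a)) | apply/PVt/PD/inrD].
Qed.

(** * Separating systems *)

Section System.
Variables (G : groupType) (adj : rel G) (N : {pred G}) (s : G -> option 'I_3).

(** The vertices with s x = None form the separating set L, and s x = Some i
    says that x lies in the i-th piece of its complement.  By the last clause,
    for n in N other than 1, the set L and its neighbours all lie in the piece
    of the complement of nL that contains 1; in particular L and nL are
    disjoint and not adjacent. *)
Record separating_system : Prop := SeparatingSystem {
  adj_sym : symmetric adj;
  adjM : forall g x y, adj (g * x) (g * y) = adj x y;
  adj_connected : forall P : G -> Prop, P 1 ->
    (forall x y, adj x y -> P x -> P y) -> forall x, P x;
  sys_group : group_closed N;
  side_one : s 1 = None;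
  side_adj : forall x y, adj x y -> s x -> s y -> s x = s y;
  side_far : forall n x y, n \in N -> n != 1 -> s x = None ->
    x = y \/ adj x y -> s (n^-1 * y) /\ s (n^-1 * y) = s n^-1 }.

Definition side n x := s (n^-1 * x).

Definition unseparated x y := forall n, n \in N -> side n x = side n y.

(** The vertex x lies in the region that is entered when leaving the translate
    nL through its i-th piece: no other translate separates x from nL.  The vertex
    x need not be adjacent to nL. *)
Definition incident n i x :=
  [/\ n \in N, side n x = Some i &
      forall n', n' \in N -> n' != n -> side n' x = side n' n].

Hypothesis sys : separating_system.

Let N1 : 1 \in N. Proof. by case: (sys_group sys). Qed.
Let NF x y : x \in N -> y \in N -> x * y^-1 \in N.
Proof. by case: (sys_group sys) => _; apply. Qed.
Let NV x : x \in N -> x^-1 \in N.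
Proof. by move=> xN; rewrite -[x^-1]mul1g NF. Qed.
Let NM x y : x \in N -> y \in N -> x * y \in N.
Proof. by move=> xN yN; rewrite -[y]invgK NF ?NV. Qed.

Lemma sideM m n x : side (m * n) (m * x) = side n x.
Proof. by rewrite /side invgM -mulgA mulKg. Qed.

Lemma side_self n : side n n = None.
Proof. by rewrite /side mulVg side_one. Qed.

Lemma side_far_translate n n' x y : n \in N -> n' \in N -> n' != n ->
  side n x = None -> x = y \/ adj x y -> side n' y /\ side n' y = side n' n.
Proof.
move=> nN n'N ne sx xy.
have [||||h e] := @side_far sys (n^-1 * n') (n^-1 * x) (n^-1 * y).
- by rewrite NM ?NV.
- by apply: contra ne => /eqP e; rewrite -[n'](mulVKg n) e mulg1.
- exact: sx.
- by case: xy => [->|xy]; [left | right; rewrite (adjM sys)].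
by move: h e; rewrite invgM invgK -mulgA mulVKg.
Qed.

(** A region is entered by any step out of a translate. *)
Lemma incident_crossing n x y : n \in N -> side n x = None -> adj x y ->
  side n y -> exists i, incident n i y.
Proof.
move=> nN sx xy; case e: (side n y) => [i|] // _; exists i; split=> // n' n'N ne.
by have [] := side_far_translate nN n'N ne sx (or_intror xy).
Qed.

Lemma incidentM m n i x : m \in N -> incident n i x -> incident (m * n) i (m * x).
Proof.
move=> mN [nN sn far]; split; rewrite ?NM ?sideM // => n' n'N ne.
rewrite -[n'](mulVKg m) !sideM; apply: far; first by rewrite NM ?NV.
by apply: contra ne => /eqP <-; rewrite mulVKg.
Qed.

Lemma incident_same n i x y : incident n i x -> incident n i y -> unseparated x y.
Proof.
move=> [nN sx fx] [_ sy fy] n' n'N; have [->|ne] := eqVneq n' n.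
  by rewrite sx sy.
by rewrite fx ?fy.
Qed.

Lemma incident_unseparated n i x y :
  unseparated x y -> incident n i x -> incident n i y.
Proof.
move=> xy [nN sx fx]; split; rewrite -?xy // => n' n'N ne.
by rewrite -xy // fx.
Qed.

Lemma unseparated_adj x y : adj x y ->
  (forall n, n \in N -> side n x /\ side n y) -> unseparated x y.
Proof.
move=> xy off n nN; have [hx hy] := off n nN.
by apply: (side_adj sys) => //; rewrite (adjM sys).
Qed.

(** * Potentials *)

Section Potential.
Variables (F : groupType) (l : G -> 'I_3 -> F).

Definition letter_of n x : F := if side n x is Some i then l n i else 1.

(** The potential of the letters attached to the translates listed in P.  Adding
    the translate nL multiplies on the left, after normalising the previous
    potential to be trivial on nL, so that steps inside a piece of the
    complement of nL keep their increment. *)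
Fixpoint pot (P : seq G) x : F :=
  if P is n :: P' then letter_of n x * (pot P' n)^-1 * pot P' x else 1.

Definition pot_diff P x y := (pot P x)^-1 * pot P y.

Lemma pot_diff_trans P x y z : pot_diff P x y * pot_diff P y z = pot_diff P x z.
Proof. by rewrite /pot_diff -mulgA mulVKg. Qed.

Lemma pot_diff_inv P x y : (pot_diff P x y)^-1 = pot_diff P y x.
Proof. by rewrite /pot_diff invgM invgK. Qed.

Lemma pot_diff_cons n P x y : side n x = side n y ->
  pot_diff (n :: P) x y = pot_diff P x y.
Proof.
move=> e; rewrite /pot_diff /= /letter_of e; set a := _ * _^-1.
by rewrite invgM -mulgA mulKg.
Qed.

Lemma pot_diff_unsep P x y :
  {in P, forall n, side n x = side n y} -> pot_diff P x y = 1.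
Proof.
elim: P => [|n P IH] e; first by rewrite /pot_diff mulVg.
rewrite pot_diff_cons ?IH // ?e ?mem_head // => n' n'P.
by rewrite e // inE n'P orbT.
Qed.

(** Both the translates before and those after n in the list contribute
    nothing, because they do not separate x from n. *)
Lemma pot_diff_incident n i x P : incident n i x -> uniq P ->
  {subset P <= N} -> n \in P -> pot_diff P n x = l n i.
Proof.
move=> inc; have [nN sx far] := inc.
elim: P => [//|n' P IH] /= /andP [n'P uP] PN.
have PN' : {subset P <= N} by move=> k kP; apply: PN; rewrite inE kP orbT.
have [e _|ne] := eqVneq n n'.
  rewrite -{}e {n'} in n'P PN *.
  have far0 : pot_diff P n x = 1.
    apply: pot_diff_unsep => k kP; rewrite far ?PN' //.
    by apply: contraNneq n'P => <-.
  rewrite /pot_diff /= /letter_of side_self sx mul1g mulVg invg1 mul1g -mulgA.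
  by rewrite -/(pot_diff P n x) far0 mulg1.
rewrite inE (negPf ne) /= => nP.
by rewrite pot_diff_cons ?IH // far ?PN ?mem_head // eq_sym.
Qed.

Lemma pot_diffM m P x y : {in P, forall n, forall i, l (m * n) i = l n i} ->
  pot_diff (map (mul m) P) (m * x) (m * y) = pot_diff P x y.
Proof.
move=> lm; suff e z : pot (map (mul m) P) (m * z) = pot P z by rewrite /pot_diff !e.
elim: P z lm => [//|n P IH] z lm /=.
have {}IH u : pot [seq m * i | i <- P] (m * u) = pot P u.
  by apply: IH => k kP; apply: lm; rewrite inE kP orbT.
rewrite !IH; congr (_ * _ * _); rewrite /letter_of sideM.
by case: (side n z) => // i; rewrite lm ?mem_head.
Qed.

(** The increment of the potential from x to y stabilises at v once the list
    contains enough translates. *)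
Definition eventually_diff x y v := exists2 P0 : seq G, {subset P0 <= N} &
  forall P, uniq P -> {subset P <= N} -> {subset P0 <= P} -> pot_diff P x y = v.

Lemma eventually_diff_trans x y z u v : eventually_diff x y u ->
  eventually_diff y z v -> eventually_diff x z (u * v).
Proof.
move=> [P0 P0N e0] [P1 P1N e1]; exists (P0 ++ P1).
  by move=> n; rewrite mem_cat => /orP [/P0N|/P1N].
move=> P uP PN P01; rewrite -(pot_diff_trans P x y) e0 ?e1 // => n nP;
by apply: P01; rewrite mem_cat nP ?orbT.
Qed.

Lemma eventually_diff_inv x y u : eventually_diff x y u -> eventually_diff y x u^-1.
Proof. by move=> [P0 P0N e0]; exists P0 => // P *; rewrite -pot_diff_inv e0. Qed.

Lemma eventually_diff_uniq x y u v :
  eventually_diff x y u -> eventually_diff x y v -> u = v.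
Proof.
move=> [P0 P0N e0] [P1 P1N e1].
have PN : {subset undup (P0 ++ P1) <= N}.
  by move=> n; rewrite mem_undup mem_cat => /orP [/P0N|/P1N].
rewrite -(e0 _ (undup_uniq _) PN) ?(e1 _ (undup_uniq _) PN) // => n nP;
by rewrite mem_undup mem_cat nP ?orbT.
Qed.

Lemma eventually_diff_unsep x y : unseparated x y -> eventually_diff x y 1.
Proof. by move=> xy; exists [::] => // P _ PN _; apply: pot_diff_unsep => n /PN/xy. Qed.

Lemma eventually_diff_incident n i x : incident n i x -> eventually_diff n x (l n i).
Proof.
move=> inc; have [nN _ _] := inc; exists [:: n]; first by move=> k; rewrite inE => /eqP->.
by move=> P uP PN nP; apply: pot_diff_incident => //; apply: nP; rewrite mem_head.
Qed.

(** At most one translate separates two adjacent vertices: the one that contains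
    exactly one of them. *)
Lemma eventually_diff_adj x y : adj x y -> exists v, eventually_diff x y v.
Proof.
have cross n u v : n \in N -> side n u = None -> adj u v ->
    exists w, eventually_diff u v w.
  move=> nN su uv; have unu : eventually_diff u n 1.
    apply: eventually_diff_unsep => n' n'N; have [->|ne] := eqVneq n' n.
      by rewrite su side_self.
    by have [] := side_far_translate nN n'N ne su (or_introl (erefl u)).
  case e: (side n v) => [i|].
    have [|j inc] := incident_crossing nN su uv; first by rewrite e.
    by eexists; apply: eventually_diff_trans unu (eventually_diff_incident inc).
  exists 1; apply: eventually_diff_unsep => n' n'N; have [->|ne] := eqVneq n' n.
    by rewrite su e.
  have [_ ->] := side_far_translate nN n'N ne su (or_introl (erefl u)).
  by have [_ ->] := side_far_translate nN n'N ne su (or_intror uv).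
move=> xy; have [[n nN sx]|offx] := pselect (exists2 n, n \in N & side n x = None).
  exact: cross nN sx xy.
have [[n nN sy]|offy] := pselect (exists2 n, n \in N & side n y = None).
  have [|v /eventually_diff_inv ?] := cross n y x nN sy; last by exists v^-1.
  by rewrite (adj_sym sys).
exists 1; apply/eventually_diff_unsep/unseparated_adj => // n nN; split.
  by case e: (side n x) => //; case: offx; exists n.
by case e: (side n y) => //; case: offy; exists n.
Qed.

Lemma potential_exists :
  exists h : G -> F, forall x y, eventually_diff x y ((h x)^-1 * h y).
Proof.
have ex x : {v | eventually_diff 1 x v}.
  apply: cid; move: x; apply: (adj_connected sys).
    by exists 1; apply: eventually_diff_unsep.
  move=> x y /eventually_diff_adj [v xy] [u x1]; exists (u * v).
  exact: eventually_diff_trans x1 xy.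
exists (fun x => sval (ex x)) => x y.
exact: eventually_diff_trans (eventually_diff_inv (svalP (ex x))) (svalP (ex y)).
Qed.

Lemma eventually_diffM m x y v : m \in N ->
  (forall n i, n \in N -> l (m * n) i = l n i) ->
  eventually_diff x y v -> eventually_diff (m * x) (m * y) v.
Proof.
move=> mN lm [P0 P0N e0]; exists (map (mul m) P0).
  by move=> _ /mapP [n /P0N nN ->]; rewrite NM.
move=> P uP PN P0P.
have eP : P = map (mul m) (map (mul m^-1) P).
  by rewrite -map_comp -[LHS]map_id; apply: eq_map => k /=; rewrite mulVKg.
have PN' : {subset map (mul m^-1) P <= N}.
  by move=> _ /mapP [k /PN kN ->]; rewrite NM ?NV.
rewrite eP pot_diffM ?e0 //.
- by rewrite map_inj_uniq //; apply: mulgI.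
- by move=> k kP0; rewrite -(mulKg m k) map_f // P0P // map_f.
- by move=> k /PN' kN i; apply: lm.
Qed.

(** The limit potential h: its increment along a path is the product of the letters
    of the passages that are crossed.  An element of N that preserves the letters
    preserves these increments, which gives the last clause because h 1 = 1. *)
Lemma crossing_potential :
  exists h : G -> F,
    [/\ h 1 = 1,
        forall x y, unseparated x y -> h x = h y,
        forall n i x, incident n i x -> h x = h n * l n i &
        forall m x, m \in N -> (forall n i, n \in N -> l (m * n) i = l n i) ->
          h (m * x) = h m * h x].
Proof.
have [h hP] := potential_exists.
have h'P x y v : eventually_diff x y v -> h y = h x * v.
  by move=> /(eventually_diff_uniq (hP x y)) <-; rewrite mulVKg.
exists (fun x => (h 1)^-1 * h x); split=> [|x y xy|n i x inc|m x mN lm].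
- by rewrite mulVg.
- by rewrite (h'P x y 1 (eventually_diff_unsep xy)) mulg1.
- by rewrite (h'P _ _ _ (eventually_diff_incident inc)) mulgA.
- have := eventually_diffM mN lm (hP 1 x); rewrite mulg1 => /h'P ->.
  by rewrite !mulgA.
Qed.

End Potential.

End System.

(** * Free quotients from separating systems *)

Lemma kernel_finite_index (G : groupType) (Q : finGroupType)
  (pi : {multiplicative G -> Q}) : finite_index [pred g | pi g == 1].
Proof.
apply: (@sub_finite_set _ _
  [set [set x | pi x = q]%classic | q in [set: Q]%classic]%classic).
  move=> _ [g _ <-]; exists (pi g) => //; apply/seteqP; split=> x /=.
    move=> e; exists (g^-1 * x); rewrite /= ?mulVKg //.
    by rewrite inE gmulfM multiplicativeV e mulVg.
  by move=> [k]; rewrite /= inE => /eqP k1 <-; rewrite gmulfM k1 mulg1.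
exact/finite_image/finite_finset.
Qed.

Lemma kernel_group_closed (G : groupType) (Q : finGroupType)
  (pi : {multiplicative G -> Q}) : group_closed [pred g | pi g == 1].
Proof.
split=> [|x y]; rewrite !inE ?multiplicative1 // => /eqP x1 /eqP y1.
by rewrite gmulfM multiplicativeV x1 y1 mulgV.
Qed.

Section Large.
Variables (G : groupType) (adj : rel G) (N : {pred G}) (s : G -> option 'I_3).
Hypothesis sys : separating_system adj N s.
Variables (Q : finGroupType) (pi : {multiplicative G -> Q}).
Hypothesis kerN : forall m, pi m = 1 -> m \in N.

Notation incident := (incident N s).

Let A := {a : Q | `[< exists2 n, n \in N & pi n = a >]}.

Let N1 : 1 \in N. Proof. by case: (sys_group sys). Qed.
Let NF x y : x \in N -> y \in N -> x * y^-1 \in N.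
Proof. by case: (sys_group sys) => _; apply. Qed.
Let NM x y : x \in N -> y \in N -> x * y \in N.
Proof. by move=> xN yN; rewrite -[y]invgK NF // -[y^-1]mul1g NF. Qed.

Let A1_subproof : `[< exists2 n, n \in N & pi n = 1 >].
Proof. by apply/asboolP; exists 1; rewrite ?multiplicative1. Qed.

Let rho n : A := insubd (Sub 1 A1_subproof : A) (pi n).

Let rhoE n : n \in N -> val (rho n) = pi n.
Proof. by move=> nN; rewrite insubdK //; apply/asboolP; exists n. Qed.

Let rho_eq n n' : n \in N -> n' \in N -> rho n = rho n' <-> pi n = pi n'.
Proof. by move=> nN n'N; rewrite -!rhoE //; split=> [->|/val_inj]. Qed.

Let rho_surj a : exists2 n, n \in N & rho n = a.
Proof.
case: a => a Pa; have /asboolP [n nN na] := Pa; exists n => //.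
by apply: val_inj; rewrite rhoE.
Qed.

Let rhoM m n : pi m = 1 -> n \in N -> rho (m * n) = rho n.
Proof.
by move=> m1 nN; apply/(rho_eq (NM (kerN m1) nN) nN); rewrite gmulfM m1 mul1g.
Qed.

(* Translates with the same image in A differ by an element of the kernel M. *)
Let transport n n' : n \in N -> n' \in N -> rho n = rho n' ->
  exists2 m, pi m = 1 & m * n = n'.
Proof.
move=> nN n'N /(rho_eq nN n'N) e; exists (n' * n^-1); last by rewrite -mulgA mulVg mulg1.
by rewrite gmulfM multiplicativeV e ?mulgV.
Qed.

Hypothesis other_side : forall i, exists n x j,
  [/\ incident 1 i x, incident n j x & pi n != 1].

(* Two passages modulo M are linked when they lead into the same region modulo
   M: the classes of this relation are the vertices of the second kind. *)
Let linked (e e' : A * 'I_3) : Prop := exists n n' x,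
  [/\ rho n = e.1, rho n' = e'.1, incident n e.2 x & incident n' e'.2 x].

Let linked_sym e e' : linked e e' -> linked e' e.
Proof. by move=> [n [n' [x []]]]; exists n', n, x. Qed.

Let incident_mem n i x : incident n i x -> n \in N. Proof. by case. Qed.

Let linked_trans e e' e'' : linked e e' -> linked e' e'' -> linked e e''.
Proof.
move=> [n [n' [x [ne n'e' xn xn']]]] [k [k' [y [ke' k'e'' yk yk']]]].
have [|||m m1 mk] := @transport k n'.
- exact: incident_mem yk.
- exact: incident_mem xn'.
- by rewrite ke'.
have mN := kerN m1; exists n, (m * k'), x; split=> //.
  by rewrite rhoM //; apply: incident_mem yk'.
apply: (incident_unseparated _ (incidentM sys mN yk')).
by apply: incident_same xn'; rewrite -mk; apply: (incidentM sys mN yk).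
Qed.

Let other_edge n i : n \in N -> exists x n' j,
  [/\ incident n i x, incident n' j x & rho n' <> rho n].
Proof.
move=> nN; have [k [x [j [x1 xk k1]]]] := other_side i.
exists (n * x), (n * k), j; split.
- by have := incidentM sys nN x1; rewrite mulg1.
- exact: (incidentM sys nN xk).
- have kN := incident_mem xk; move/(rho_eq (NM nN kN) nN); rewrite gmulfM => e.
  by case/eqP: k1; apply: (mulgI (pi n)); rewrite mulg1.
Qed.

(* Connectedness of the Cayley graph gives that of the finite graph: the vertex
   of the latter on which x lies changes along an edge only through a passage. *)
Let connected (U : A -> Prop) (W : A * 'I_3 -> Prop) : U (rho 1) ->
  (forall e e', linked e e' -> W e -> W e') ->
  (forall e, U e.1 <-> W e) -> forall a, U a.
Proof.
move=> U1 RW UW a; have [n nN <-] := rho_surj a; move: n nN.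
(* The vertex of the finite graph on which x lies belongs to U or W. *)
pose good x := (forall n, n \in N -> side s n x = None -> U (rho n)) /\
  (forall n i, incident n i x -> W (rho n, i)).
suff all_good : forall x, good x.
  by move=> n nN; apply: (all_good n).1 => //; apply: side_self sys _.
have goodK n x : n \in N -> side s n x = None -> U (rho n) -> good x.
  move=> nN sx Un; split=> [n' n'N sx'|n' i [n'N sx' far]].
    have [->//|ne] := eqVneq n' n.
    have := side_far_translate sys nN n'N ne sx (or_introl (erefl x)).
    by rewrite sx'; case.
  have [e|ne] := eqVneq n n'; first by rewrite -e sx in sx'.
  have [] := side_far_translate sys n'N nN ne (side_self sys n') (or_introl (erefl n')).
  by rewrite -far // sx.
apply: (adj_connected sys) => [|x y xy [gU gW]].
  by apply: (goodK 1 1) => //; apply: side_self sys _.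
have [[n nN sy]|offy] := pselect (exists2 n, n \in N & side s n y = None).
  apply: (goodK n y nN sy); case e: (side s n x) => [i|]; last exact: gU.
  have [||j inc] := incident_crossing sys nN sy (y := x).
  - by rewrite (adj_sym sys).
  - by rewrite e.
  - exact/(UW (rho n, j))/gW.
split=> [n nN sy|n' i inc]; first by case: offy; exists n.
have [[n nN sx]|offx] := pselect (exists2 n, n \in N & side s n x = None).
  have [|j incn] := incident_crossing sys nN sx xy.
    by case e: (side s n y) => //; case: offy; exists n.
  by apply: (RW (rho n, j)); [exists n, n', y | apply/(UW (rho n, j))/gU].
apply: gW; apply: (incident_unseparated _ inc) => n nN; apply/esym.
move: n nN; apply: (unseparated_adj sys xy) => n nN; split.
  by case e: (side s n x) => //; case: offx; exists n.
by case e: (side s n y) => //; case: offy; exists n.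
Qed.

(** The spanning tree carries trivial letters, so every vertex of the finite
    graph is the image of some vertex x with h x = 1.  Crossing a spare edge
    from there and coming back to the orbit of 1 at no cost gives an element
    of M on which h takes the letter of that edge. *)
Lemma large_of_system : large G.
Proof.
pose R : rel (A * 'I_3) := fun e e' => `[< linked e e' >].
have linked_refl e : linked e e.
  have [n nN ne] := rho_surj e.1; have [x [_ [_ [inc _ _]]]] := other_edge e.2 nN.
  by exists n, n, x.
have [|||U W Ua0 RW UW a|e1 [e2 [ne12 span]]] := @two_spare_edges A R (rho 1).
- move=> e e' e''; split=> [|/asboolP ee']; first exact/asboolP.
  apply/asboolP/asboolP; last exact: linked_trans.
  exact: linked_trans (linked_sym ee').
- have [x [n [j [_ incn ne]]]] := other_edge ord0 N1.
  by apply/card_gt1P; exists (rho n), (rho 1); split=> //; apply/eqP.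
- move=> e; have [n nN ne] := rho_surj e.1.
  have [x [n' [j [inc inc' ne']]]] := other_edge e.2 nN.
  exists (rho n', j); last by apply/asboolP; exists n, n', x.
  by apply/eqP => e'; apply: ne'; rewrite ne -e'.
- apply: (@connected (fun a => a \in U) (fun e => e \in W)) => //.
    by move=> e e' ee'; apply: RW; apply/asboolP.
  by move=> e; rewrite UW.
pose F := free_group bool.
pose L e : F := if e == e1 then letter true else if e == e2 then letter false else 1.
have [h [h1 hsep hinc hM]] := crossing_potential sys (fun n i => L (rho n, i)).
have {}hM m x : pi m = 1 -> h (m * x) = h m * h x.
  by move=> m1; apply: hM => [|n i nN]; [exact: kerN | rewrite rhoM].
have hL n e x : rho n = e.1 -> incident n e.2 x -> h x = h n * L e.
  by case: e => a i /= <-; apply: hinc.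
have hmove m n n' i x y : pi m = 1 -> m * n = n' -> incident n i x ->
    incident n' i y -> h y = h m * h x.
  move=> m1 mn nx n'y; rewrite -hM //; apply: hsep; apply: incident_same n'y _.
  by rewrite -mn; apply: (incidentM sys (kerN m1) nx).
have [|||reachA reachE] := span
  (fun a => exists n, [/\ n \in N, rho n = a & h n = 1])
  (fun e => exists n x, [/\ rho n = e.1, incident n e.2 x & h x = 1]).
- by exists 1.
- move=> e e' /asboolP [n [n' [y [ne n'e' ny n'y]]]] [k [x [ke kx hx]]].
  have nN := incident_mem ny; have kN := incident_mem kx.
  have [|m m1 mn] := transport nN kN; first by rewrite ne.
  have mN := kerN m1; have ky := incidentM sys mN ny.
  exists (m * n'), (m * y); split.
  + by rewrite rhoM //; apply: incident_mem n'y.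
  + exact: (incidentM sys mN n'y).
  + by rewrite -hx; apply: hsep; apply: incident_same kx; rewrite -mn.
- move=> e n1 n2; have L1 : L e = 1 by rewrite /L (negPf n1) (negPf n2).
  split=> [[n [nN ne hn]]|[n [x [ne nx hx]]]].
    have [x [_ [_ [nx _ _]]]] := other_edge e.2 nN.
    by exists n, x; rewrite (hL _ _ _ ne nx) L1 hn mulg1.
  exists n; split=> //; first exact: incident_mem nx.
  by rewrite -hx (hL _ _ _ ne nx) L1 mulg1.
have hits e : exists2 m, pi m = 1 & h m = L e.
  have [n [nN ne hn]] := reachA e.1; have [k [y [ke ky hy]]] := reachE e.
  have [x [_ [_ [nx _ _]]]] := other_edge e.2 nN.
  have [|m m1 mk] := transport (incident_mem ky) nN; first by rewrite ke.
  exists m => //; have := hmove m k n e.2 y x m1 mk ky nx.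
  by rewrite (hL _ _ _ ne nx) hn mul1g hy mulg1.
exists ([pred g | pi g == 1] : {pred G}); split.
- exact: kernel_group_closed.
- exact: kernel_finite_index.
exists F, h; split.
- exact: free_group_is_free.
- exact: (@free_group_nonabelian _ true false).
- by move=> x y; rewrite inE => /eqP x1 _; apply: hM.
suff onto z : exists2 x, pi x = 1 & h x = z.
  by move=> z; have [x x1 hx] := onto z; exists x; rewrite ?inE ?x1.
elim/free_group_ind: z => [|i|x [m m1 hm]|x y [m m1 hm] [k k1 hk]].
- by exists 1; rewrite ?multiplicative1.
- case: i.
  + by have [m m1 hm] := hits e1; exists m; rewrite // hm /L eqxx.
  + by have [m m1 hm] := hits e2; exists m; rewrite // hm /L eq_sym (negPf ne12) eqxx.
- exists m^-1; first by rewrite multiplicativeV m1 invg1.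
  by apply: (mulgI (h m)); rewrite -hM // !mulgV h1 hm mulgV.
- by exists (m * k); rewrite ?gmulfM ?m1 ?k1 ?mulg1 // hM // hm hk.
Qed.
End Large.

(** * Finite quotients *)

Section PairMorphism.
Variables (G : groupType) (Q1 Q2 : finGroupType).
Variables (phi : {multiplicative G -> Q1}) (psi : {multiplicative G -> Q2}).
Definition pair_mor (g : G) : Q1 * Q2 := (phi g, psi g).
Lemma pair_morM : {morph pair_mor : x y / x * y}.
Proof. by move=> x y; rewrite /pair_mor !gmulfM. Qed.
HB.instance Definition _ := isMultiplicative.Build G (Q1 * Q2)%type pair_mor pair_morM.
Definition pairM : {multiplicative G -> (Q1 * Q2)%type} := pair_mor.
Lemma pairM_eq1 g : pairM g = 1 <-> phi g = 1 /\ psi g = 1.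
Proof. by split=> [[-> ->]|[e1 e2]] //; rewrite /pairM /= /pair_mor e1 e2. Qed.
End PairMorphism.

Lemma residually_finite_avoid (G : groupType) (X : seq G) : residually_finite G ->
  exists (Q : finGroupType) (phi : {multiplicative G -> Q}),
    {in X, forall x, x != 1 -> phi x != 1}.
Proof.
move=> rf; elim: X => [|x X [Q [phi phiX]]].
  by exists {perm 'I_1}, (@one_fun G {perm 'I_1}).
have [->|/rf [Q' [psi psix]]] := eqVneq x 1.
  by exists Q, phi => y; rewrite inE => /orP [/eqP-> /eqP //|]; apply: phiX.
exists (Q' * Q)%type, (pairM psi phi) => y yX y1; apply/eqP => /pairM_eq1 [psi1 phi1].
move: yX; rewrite inE => /orP [/eqP e|yX]; last first.
  by have := phiX y yX y1; rewrite phi1 eqxx.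
by move: psix; rewrite -e psi1 eqxx.
Qed.

(** * Cayley graphs *)

Section CayleyGraph.
Variables (G : groupType) (S : {fset G}).
Notation adj := (cayley_graph S).

Lemma cayley_sym : symmetric adj.
Proof. by move=> x y; rewrite /cayley_graph orbC. Qed.

Lemma cayleyM g x y : adj (g * x) (g * y) = adj x y.
Proof. by rewrite /cayley_graph !invgM -!mulgA !mulKg. Qed.

(** The elements by which right multiplication preserves and reflects P form a
    subgroup that contains the generators. *)
Lemma cayley_connected (P : G -> Prop) : generates S -> P 1 ->
  (forall x y, adj x y -> P x -> P y) -> forall x, P x.
Proof.
move=> genS P1 Padj x.
pose H : {pred G} := [pred x | `[< forall y, P y <-> P (y * x) >]].
have /asboolP/(_ 1) : x \in H; last by rewrite mul1g => <-.
apply: genS => [|s sS].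
  split; first by apply/asboolP => y; rewrite mulg1.
  move=> u v /asboolP uH /asboolP vH; apply/asboolP => y.
  by rewrite (uH y) (vH (y * (u * v^-1))) !mulgA mulgVK.
by apply/asboolP => y; split; apply: Padj; rewrite /cayley_graph mulKg sS ?orbT.
Qed.

Definition neighbours (L : seq G) : seq G :=
  [seq x * s | x <- L, s <- enum_fset S] ++ [seq x * s^-1 | x <- L, s <- enum_fset S].

Lemma mem_neighbours L x y : x \in L -> adj x y -> y \in neighbours L.
Proof.
move=> xL /orP [sS|sS]; rewrite mem_cat; apply/orP; [left|right].
  by apply/allpairsP; exists (x, x^-1 * y); rewrite /= mulVKg.
by apply/allpairsP; exists (x, y^-1 * x); rewrite /= invgM invgK mulVKg.
Qed.

(** Connectedness of the subgraph induced on L, as an induction principle from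
    the base point 1. *)
Definition rooted_connected (L : seq G) := 1 \in L /\
  forall P : G -> Prop, P 1 ->
    (forall x y, x \in L -> y \in L -> adj x y -> P x -> P y) ->
    {in L, forall x, P x}.

Lemma rooted_connected_cat L M :
  rooted_connected L -> rooted_connected M -> rooted_connected (L ++ M).
Proof.
move=> [L1 connL] [_ connM]; split=> [|P P1 Padj x]; first by rewrite mem_cat L1.
rewrite mem_cat => /orP [xL|xM].
  by apply: connL xL => // u v uL vL; apply: Padj; rewrite mem_cat ?uL ?vL.
by apply: connM xM => // u v uM vM; apply: Padj; rewrite mem_cat ?uM ?vM orbT.
Qed.

Lemma rooted_connected_sup (X : seq G) : generates S ->
  exists2 L, {subset X <= L} & rooted_connected L.
Proof.
move=> genS.
have one x : exists2 L, x \in L & rooted_connected L.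
  move: x; apply: (cayley_connected genS) => [|x y xy [L xL [L1 connL]]].
    exists [:: 1]; first exact: mem_head.
    by split=> [|P P1 _ x]; rewrite inE // => /eqP ->.
  exists (y :: L); first exact: mem_head.
  split=> [|P P1 Padj z]; first by rewrite inE L1 orbT.
  have PL : {in L, forall u, P u}.
    by apply: connL => // u v uL vL; apply: Padj; rewrite inE ?uL ?vL orbT.
  rewrite inE => /orP [/eqP ->|/PL //].
  by apply: (Padj x y); rewrite ?inE ?eqxx ?xL ?orbT //; apply: PL.
elim: X => [|x X [L XL connL]]; first by have [L _] := one 1; exists L.
have [M xM connM] := one x; exists (M ++ L); last exact: rooted_connected_cat.
move=> y; rewrite inE mem_cat => /orP [/eqP ->|/XL ->]; rewrite ?orbT //.
by rewrite xM.
Qed.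

End CayleyGraph.

(** * Ends *)

Section Ends.
Variables (V : choiceType) (e : rel V).
Hypothesis e_sym : symmetric e.

Lemma joined_outside_refl (K : {fset V}) x : x \notin K -> joined_outside e K x x.
Proof. by exists [::]; rewrite /= andbT. Qed.

Lemma joined_outside_trans (K : {fset V}) x y z :
  joined_outside e K x y -> joined_outside e K y z -> joined_outside e K x z.
Proof.
move=> [p [xp py xpK]] [q [yq qz /= /andP [_ qK]]]; exists (p ++ q).
by rewrite cat_path last_cat py xp yq -cat_cons all_cat xpK qK.
Qed.

Lemma joined_outside_sym (K : {fset V}) x y :
  joined_outside e K x y -> joined_outside e K y x.
Proof.
move=> [p [xp <- xpK]]; exists (rev (belast x p)); split.
- by rewrite rev_path (eq_path (e' := e)) // => u v; rewrite e_sym.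
- by case: p xp xpK => [//|z p] _ _; rewrite /= rev_cons last_rcons.
- by rewrite -rev_rcons -lastI all_rev.
Qed.

Lemma joined_outside_adj (K : {fset V}) x y :
  x \notin K -> y \notin K -> e x y -> joined_outside e K x y.
Proof. by move=> xK yK xy; exists [:: y]; rewrite /= xy xK yK. Qed.

Lemma joined_outside_notin (K : {fset V}) x y : joined_outside e K x y -> y \notin K.
Proof. by move=> [p [_ <- /allP]]; apply; apply: mem_last. Qed.

Lemma joined_outside_ind (K : {fset V}) (P : V -> Prop) x y : P x ->
  (forall u v, joined_outside e K x u -> joined_outside e K x v -> e u v -> P u -> P v) ->
  joined_outside e K x y -> P y.
Proof.
move=> Px PK [p [xp py xpK]].
have xx : joined_outside e K x x by apply: joined_outside_refl; case/andP: xpK.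
suff gen u : joined_outside e K x u -> P u -> path e u p -> last u p = y ->
    all [pred v | v \notin K] (u :: p) -> P y by apply: (gen x).
elim: p u {xp py xpK} => [|z p IH] u xu Pu /=; first by move=> _ <-.
move=> /andP [uz zp] py /andP [uK zpK].
have xz : joined_outside e K x z.
  apply: joined_outside_trans xu _; apply: joined_outside_adj => //.
  by case/andP: zpK.
by apply: (IH z) => //; apply: PK uz Pu.
Qed.

Lemma component_joined (K : {fset V}) (C : set V) x y :
  component_outside e K C -> C x -> C y <-> joined_outside e K x y.
Proof.
move=> [z _ ->] /= zx; split=> [zy|]; last exact: joined_outside_trans.
exact: joined_outside_trans (joined_outside_sym zx) zy.
Qed.

Lemma component_notin (K : {fset V}) (C : set V) x :
  component_outside e K C -> C x -> x \notin K.
Proof. by move=> [z _ ->] /joined_outside_notin. Qed.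

Lemma component_eq (K : {fset V}) (C C' : set V) x :
  component_outside e K C -> component_outside e K C' -> C x -> C' x -> C = C'.
Proof.
move=> KC KC' Cx C'x; apply/seteqP; split=> y.
  by move/(component_joined _ KC Cx)/(component_joined _ KC' C'x).
by move/(component_joined _ KC' C'x)/(component_joined _ KC Cx).
Qed.

(** A component picked by an end is infinite: the component that the same end
    picks outside the union of K and X is contained in it and avoids X. *)
Lemma end_unbounded w (K X : {fset V}) : ends e w -> exists2 x, w K x & x \notin X.
Proof.
move=> [wK wm]; have [x xKX wKX] := wK (K `|` X)%fset.
have wx : w (K `|` X)%fset x by rewrite wKX; apply: joined_outside_refl.
exists x; first by apply: wm wx; apply: fsubsetUl.
by move: xKX; rewrite in_fsetU negb_or => /andP [].
Qed.

(** Components outside K that differ are disjoint, and remain so for larger sets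
    since those picked by an end decrease. *)
Lemma ends_separated w w' : ends e w -> ends e w' -> w <> w' ->
  exists K0 : {fset V}, forall K x, (K0 `<=` K)%fset -> w K x -> ~ w' K x.
Proof.
move=> [wK wm] [wK' wm'] ne.
have [K0 neK0] : exists K0, w K0 <> w' K0.
  apply: contrapT => same; apply: ne; apply: funext => K.
  by apply: contrapT => neK; apply: same; exists K.
exists K0 => K x K0K wx wx'; apply: neK0.
exact: component_eq (wK K0) (wK' K0) (wm _ _ K0K _ wx) (wm' _ _ K0K _ wx').
Qed.

Lemma three_ends : infinite_set (ends e) ->
  exists w : 'I_3 -> {fset V} -> set V, (forall i, ends e (w i)) /\
    exists K0 : {fset V}, forall K i j x, (K0 `<=` K)%fset ->
      w i K x -> w j K x -> i = j.
Proof.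
move=> inf; have [w0 e0] := infinite_setN0 inf.
have [w1 [e1 n1]] := infinite_setN0 (infinite_setD inf (finite_set1 w0)).
have [w2 [e2 n2]] := infinite_setN0 (infinite_setD inf (finite_set2 w0 w1)).
have [K01 K01P] := ends_separated e0 e1 (fun h => n1 (esym h)).
have [K02 K02P] := ends_separated e0 e2 (fun h => n2 (or_introl (esym h))).
have [K12 K12P] := ends_separated e1 e2 (fun h => n2 (or_intror (esym h))).
exists (fun i : 'I_3 => nth w0 [:: w0; w1; w2] i); split.
  by case=> [[|[|[|]]]].
exists (K01 `|` K02 `|` K12)%fset => K i j x.
rewrite !fsubUset => /andP [/andP [k01 k02] k12].
case: i => [[|[|[|//]]] ?]; case: j => [[|[|[|//]]] ?] /= wi wj; apply: val_inj => //=.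
- by case: (K01P K x).
- by case: (K02P K x).
- by case: (K01P K x).
- by case: (K12P K x).
- by case: (K02P K x).
- by case: (K12P K x).
Qed.

(** The set W i is an infinite connected component of the complement of L that
    is contained in the i-th piece; the piece itself may be disconnected. *)
Record three_sides (L : {fset V}) (s : V -> option 'I_3) (W : 'I_3 -> V -> Prop) :
    Prop := ThreeSides {
  sides_none : forall x, s x = None <-> x \in L;
  sides_adj : forall x y, e x y -> s x -> s y -> s x = s y;
  region_side : forall i x, W i x -> s x = Some i;
  region_unbounded : forall i (X : {fset V}), exists2 x, W i x & x \notin X;
  region_adj : forall i x y, W i x -> e x y -> y \notin L -> W i y;
  region_connected : forall i (P : V -> Prop) x y, W i x -> W i y -> P x ->
    (forall u v, W i u -> W i v -> e u v -> P u -> P v) -> P y }.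

(** The first two pieces are the components picked by two of the ends, and the
    third piece is the rest of the complement of L. *)
Lemma three_sides_exist : infinite_set (ends e) -> exists K0 : {fset V},
  forall L, (K0 `<=` L)%fset -> exists s W, three_sides L s W.
Proof.
case/three_ends=> w [wE [K0 K0P]]; exists K0 => L K0L.
have sep i j x := K0P L i j x K0L.
have wC i : component_outside e L (w i L) by case: (wE i).
have wadj i x y : w i L x -> e x y -> y \notin L -> w i L y.
  move=> wx xy yL; apply/(component_joined _ (wC i) wx)/joined_outside_adj => //.
  exact: component_notin (wC i) wx.
pose i0 : 'I_3 := inord 0; pose i1 : 'I_3 := inord 1; pose i2 : 'I_3 := inord 2.
pose s x := if x \in L then None else if `[< w i0 L x >] then Some i0
  else if `[< w i1 L x >] then Some i1 else Some i2.
exists s, (fun i => w i L); split.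
- by move=> x; rewrite /s; case: (x \in L); [|case: ifP => _; [|case: ifP => _]]; split.
- move=> x y xy; rewrite /s; case: (boolP (x \in L)) => // xL _.
  case: (boolP (y \in L)) => // yL _; rewrite -(_ : `[< w i0 L x >] = `[< w i0 L y >]).
    rewrite -(_ : `[< w i1 L x >] = `[< w i1 L y >]) //.
    by apply: asbool_equiv_eq; split=> h; apply: wadj h _ _; rewrite // e_sym.
  by apply: asbool_equiv_eq; split=> h; apply: wadj h _ _; rewrite // e_sym.
- move=> i x wx; rewrite /s (negPf (component_notin (wC i) wx)).
  case: asboolP => [w0|n0]; first by rewrite (sep _ _ _ wx w0).
  case: asboolP => [w1|n1]; first by rewrite (sep _ _ _ wx w1).
  congr Some; apply: val_inj; rewrite /= inordK //.
  case: i wx => [[|[|[|//]]] lti] wx //=.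
    by case: n0; rewrite (_ : i0 = Ordinal lti) //; apply: val_inj; rewrite /= inordK.
  by case: n1; rewrite (_ : i1 = Ordinal lti) //; apply: val_inj; rewrite /= inordK.
- by move=> i X; apply: end_unbounded.
- exact: wadj.
- move=> i P x y wx /(component_joined _ (wC i) wx) xy Px PW.
  apply: joined_outside_ind Px _ xy => u v xu xv uv.
  by apply: PW uv; apply/(component_joined _ (wC i) wx).
Qed.

End Ends.

(** * Regions between translates *)

Section Regions.
Variables (G : groupType) (adj : rel G) (N : {pred G}) (L : {fset G}).
Variables (s : G -> option 'I_3) (W : 'I_3 -> G -> Prop).
Hypotheses (sys : separating_system adj N s) (regions : three_sides adj L s W).
Variables (reps J : seq G).
Hypothesis cosets : forall x, exists2 r, r \in reps & x * r^-1 \in N.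
Hypotheses (repsJ : {subset reps <= J})
  (connJ : forall P : G -> Prop, P 1 ->
    (forall x y, x \in J -> y \in J -> adj x y -> P x -> P y) ->
    {in J, forall x, P x}).

(** A vertex z of W i is n r for some n in N and some r among finitely many coset
    representatives.  If z is far from L then the connected set nJ, which
    contains n and z, misses L, so that n stays in the component W i. *)
Lemma region_meets_subgroup i : exists2 n, n \in N & W i n.
Proof.
pose X : {fset G} := [fset z in
  [seq y * r | y <- [seq l * j^-1 | l <- enum_fset L, j <- J], r <- reps]]%fset.
have [z Wz zX] := region_unbounded regions i X; have [r rR nN] := cosets z.
exists (z * r^-1) => //; set n := z * r^-1; apply: contrapT => nW.
have off y : y \in J -> n * y \notin L.
  move=> yJ; apply: contra zX => yL; rewrite in_fset; apply/allpairsP.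
  exists (n, r); split=> //=; last by rewrite /n mulgVK.
  by apply/allpairsP; exists (n * y, y); rewrite /= mulgK.
suff /(_ r (repsJ rR)) : {in J, forall y, ~ W i (n * y)} by rewrite /n mulgVK.
apply: connJ => [|x y xJ yJ xy nWx Wy]; first by rewrite mulg1.
apply: nWx; apply: (region_adj regions Wy); last exact: off.
by rewrite (adjM sys) (adj_sym sys).
Qed.

(** Walk inside W i from a neighbour of L to a point of N: as long as no
    translate is met, the walk stays in the region entered through the i-th
    piece, and the last vertex before the first translate is next to it. *)
Lemma region_two_translates i : exists n x j,
  [/\ incident N s 1 i x, incident N s n j x & n != 1].
Proof.
have [n nN Wn] := region_meets_subgroup i.
have N1 : 1 \in N by case: (sys_group sys).
have s1 : side s 1 1 = None := side_self sys 1.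
have sideW x : W i x -> side s 1 x = Some i.
  by move=> /(region_side regions); rewrite /side invg1 mul1g.
have notW1 : ~ W i 1 by move=> /sideW; rewrite s1.
have [l [x0 [lL lx0 Wx0]]] : exists l x0, [/\ side s 1 l = None, adj l x0 & W i x0].
  apply: contrapT => none; suff : forall x, ~ W i x by move/(_ n).
  apply: (adj_connected sys) => // x y xy nWx Wy; case e: (side s 1 x) => [k|].
    apply: nWx; apply: (region_adj regions Wy); first by rewrite (adj_sym sys).
    by apply/negP => /(sides_none regions) e'; move: e; rewrite /side invg1 mul1g e'.
  by apply: none; exists x, y.
have [|j inc0] := incident_crossing sys N1 lL lx0; first by rewrite sideW.
have {j inc0} inc0 : incident N s 1 i x0.
  by have [_ e _] := inc0; move: e inc0; rewrite sideW // => -[->].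
(* The vertices of the region entered through the i-th piece of L. *)
pose same x := unseparated N s x0 x /\ forall n, n \in N -> side s n x.
have same0 : same x0.
  split=> // m mN; have [->|ne] := eqVneq m 1; first by rewrite sideW.
  by have [] := side_far_translate sys N1 mN ne lL (or_intror lx0).
have [u [v [Wu Wv uv su nsv]]] : exists u v,
    [/\ W i u, W i v, adj u v, same u & ~ same v].
  apply: contrapT => none.
  suff [_ /(_ n nN)] : same n by rewrite (side_self sys).
  apply: (region_connected regions Wx0 Wn same0) => u v Wu Wv uv su.
  by apply: contrapT => nsv; apply: none; exists u, v.
have [x0u offu] := su.
have [m mN sv] : exists2 m, m \in N & side s m v = None.
  apply: contrapT => none; apply: nsv.
  have offv m : m \in N -> side s m v.
    by move=> mN; case e: (side s m v) => //; case: none; exists m.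
  split=> // m mN; rewrite x0u //.
  by apply: (unseparated_adj sys uv) => // k kN; rewrite offu ?offv.
have [||j incm] := incident_crossing sys mN sv (y := u).
- by rewrite (adj_sym sys).
- exact: offu.
exists m, u, j; split=> //; first exact: incident_unseparated inc0.
by apply/eqP => m1; move: sv; rewrite m1 sideW.
Qed.

End Regions.

Lemma finite_coset_representatives (G : groupType) (Q : finGroupType)
  (phi : {multiplicative G -> Q}) :
  exists reps : seq G, forall x, exists2 r, r \in reps & phi (x * r^-1) = 1.
Proof.
(* Elements of Q outside the image get the junk representative 1. *)
pose rep (q : Q) : G := if pselect (exists g, phi g = q) is left h
  then projT1 (cid h) else 1.
exists [seq rep q | q <- enum Q] => x.
exists (rep (phi x)); first by apply: map_f; rewrite mem_enum.
rewrite /rep; case: pselect => [h|[]]; last by exists x.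
by rewrite gmulfM multiplicativeV (projT2 (cid h)) mulgV.
Qed.

(** The set L, being connected and disjoint from its translate by n, lies in a
    single piece of the complement of that translate. *)
Lemma separating_system_of_sides (G : groupType) (S L : {fset G})
    (N : {pred G}) (s : G -> option 'I_3) (W : 'I_3 -> G -> Prop) :
  generates S -> rooted_connected S (enum_fset L) ->
  three_sides (cayley_graph S) L s W -> group_closed N ->
  (forall n x y, n \in N -> n != 1 -> x \in L ->
    x = y \/ cayley_graph S x y -> n^-1 * y \notin L) ->
  separating_system (cayley_graph S) N s.
Proof.
move=> genS [L1 connL] sidesL grN far.
have sN x : (s x : bool) = (x \notin L).
  have := sides_none sidesL x; case: (s x) => [i|] [h h'].
    by apply/esym/negP => /h'.
  by rewrite h.
have adjN x y n : cayley_graph S x y -> n^-1 * x \notin L -> n^-1 * y \notin L ->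
    s (n^-1 * x) = s (n^-1 * y).
  by move=> xy xL yL; apply: (sides_adj sidesL); rewrite ?cayleyM ?sN.
split=> //.
- exact: cayley_sym.
- exact: cayleyM.
- by move=> P; apply: cayley_connected.
- exact/(sides_none sidesL).
- exact: (sides_adj sidesL).
move=> n x y nN n1 /(sides_none sidesL) xL xy.
have inL u : u \in L -> s (n^-1 * u) = s n^-1.
  apply: (connL (fun u => s (n^-1 * u) = s n^-1)) => [|{}u v uL vL uv <-].
    by rewrite mulg1.
  apply/esym/adjN => //; first by apply: (far n u) => //; left.
  by apply: (far n v) => //; left.
split; first by rewrite sN; apply: far xL xy.
case: xy => [<-|xy]; first exact: inL.
rewrite -(inL x xL); apply/esym/adjN => //.
  by apply: (far n x) => //; left.
by apply: (far n x) => //; right.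
Qed.

Theorem theorem7p2 (G : groupType) :
  finitely_generated G ->
  residually_finite G ->
  has_infinitely_many_ends G ->
  large G.
Proof.
move=> _ rf [S genS inf].
have [K0 K0P] := three_sides_exist (@cayley_sym _ S) inf.
have [L' K0L' connL'] := rooted_connected_sup (enum_fset K0) genS.
pose L : {fset G} := [fset x in L']%fset.
have memL x : (x \in L) = (x \in L') by rewrite in_fset.
have connL : rooted_connected S (enum_fset L).
  have [L1 conn] := connL'; split=> [|P P1 PL x]; first by rewrite memL.
  by rewrite memL; apply: conn => // u v uL vL; apply: PL; rewrite memL.
have [|s [W sidesL]] := K0P L.
  by apply/fsubsetP => x xK0; rewrite memL K0L'.
(* The elements n for which nL meets L or its neighbours. *)
pose X := [seq y * l^-1 | y <- L' ++ neighbours S L', l <- L'].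
have [Q0 [phi0 phi0X]] := residually_finite_avoid X rf.
pose N : {pred G} := [pred g | phi0 g == 1].
have sys : separating_system (cayley_graph S) N s.
  apply: separating_system_of_sides genS connL sidesL (kernel_group_closed phi0) _.
  move=> n x y; rewrite inE memL => nN n1 xL xy; apply: contraL nN => nyL.
  apply: phi0X n1; apply/allpairsP; exists (y, n^-1 * y); split=> /=.
  - rewrite mem_cat; case: xy => [<-|xy]; first by rewrite xL.
    by rewrite (mem_neighbours xL xy) orbT.
  - by rewrite -memL.
  - by rewrite invgM invgK mulVKg.
have [reps repsP] := finite_coset_representatives phi0.
have [J repsJ [_ connJ]] := rooted_connected_sup reps genS.
have cosets x : exists2 r, r \in reps & x * r^-1 \in N.
  by have [r rR r1] := repsP x; exists r; rewrite // inE r1.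
have [n nP] := choice (region_two_translates sys sidesL cosets repsJ connJ).
(* The subgroup M is the intersection of N with the kernel of phi1. *)
have [Q1 [phi1 phi1X]] := residually_finite_avoid [seq n i | i <- enum 'I_3] rf.
apply: (large_of_system sys (pi := pairM phi0 phi1)).
  by move=> m /pairM_eq1 [m1 _]; rewrite inE m1.
move=> i; have [x [j [incx incn n1]]] := nP i; exists (n i), x, j; split=> //.
apply/eqP => /pairM_eq1 [_ /eqP]; apply/negP.
by apply: phi1X n1; apply: map_f; rewrite mem_enum.
Qed.
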